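(* Let $F$ be the free monoid with basis $\{x,y,y',z,z'\}$, let $T$ be the right $F$-set defined in the context, and let $F[T]$ be the monoid constructed from this action. Then the direct product $F[T]\times\mathbb{Z}$ has a prefix-closed regular cross-section.
   Context: **Monoid from an action.** Let $M$ be a monoid acting from the right on a set $T$. The monoid $M[T]$ is the disjoint union $M\cup T$, with multiplication in $M$ as before and otherwise defined by $tm=t\cdot m$, $mt=t$, $ty=y$ for all $t,y\in T$, $m\in M$. This multiplication is associative. **The action.** $\mathbb{N}$ denotes the positive integers, and $\mathbb{B}=\{2^k : k\in\mathbb{N}\cup\{0\}\}$. Let $P=\{p_{\alpha,\beta} : \alpha\in\mathbb{N}\cup\{0\},\ \beta\in\mathbb{Z}\}$ (distinct symbols) and $T=P\cup\{\Omega\}$, where $\Omega\notin P$. The free monoid $F$ on $\{x,y,y',z,z'\}$ acts on $T$ from the right via the following action of its generators: - $p_{\alpha,\beta}\cdot x = p_{\alpha+1,0}$ if $\beta=0$, and $=\Omega$ if $\beta\neq 0$; - $p_{\alpha,\beta}\cdot y = p_{\alpha,\beta+1}$ if $\alpha\notin\mathbb{B}$; $=p_{\alpha,0}$ if $\alpha\in\mathbb{B}$ and $\beta=0$; $=\Omega$ if $\alpha\in\mathbb{B}$ and $\beta\neq0$; - $p_{\alpha,\beta}\cdot y' = p_{\alpha,\beta-1}$ if $\alpha\notin\mathbb{B}$; $=p_{\alpha,0}$ if $\alpha\in\mathbb{B}$ and $\beta=0$; $=\Omega$ if $\alpha\in\mathbb{B}$ and $\beta\neq0$; - $p_{\alpha,\beta}\cdot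 z = p_{\alpha,\beta}$ if $\alpha\notin\mathbb{B}$, and $=p_{\alpha,\beta+1}$ if $\alpha\in\mathbb{B}$; - $p_{\alpha,\beta}\cdot z' = p_{\alpha,\beta}$ if $\alpha\notin\mathbb{B}$, and $=p_{\alpha,\beta-1}$ if $\alpha\in\mathbb{B}$; - $\Omega\cdot x=\Omega\cdot y=\Omega\cdot y'=\Omega\cdot z=\Omega\cdot z'=\Omega$. **Cross-sections.** A cross-section for a monoid $N$ is a language $L\subseteq A^*$ over some generating set $A$ for $N$ (elements of $A$ being viewed as letters; here $A$ is finite) such that every element of $N$ is represented by exactly one word in $L$. It is regular if $L$ is a regular language, and prefix-closed if every prefix (including the empty word) of every word in $L$ lies in $L$. $\mathbb{Z}$ is the additive group of integers (the free group of rank $1$), viewed as a monoid. *)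

(* Defs.v *)
From HB Require Import structures.
From mathcomp Require Import all_boot all_order all_algebra.
From mathcomp Require Import finmap.

Set Implicit Arguments.
Unset Strict Implicit.
Unset Printing Implicit Defensive.

Local Open Scope group_scope.

(* [(N1 * N2)%type] carries MathComp's direct-product monoid, and
   [Algebra.to_multiplicative int] is the additive group of integers with its
   operation written multiplicatively. *)

Definition free_monoid (X : Type) : Type := seq X.

HB.instance Definition _ (X : choiceType) := Choice.on (free_monoid X).
HB.instance Definition _ (X : choiceType) :=
  isMonoid.Build (free_monoid X) (@catA X) (@cat0s X) (@cats0 X).

Record right_action (M : monoidType) (T : Type) := RightAction {
  ract :> T -> M -> T;
  ract1 : forall t, ract t 1 = t;
  ractM : forall t m n, ract t (m * n) = ract (ract t m) n
}.

Section ActionMonoid.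
Variables (M : monoidType) (T : choiceType) (act : right_action M T).

(* [inl] embeds M and [inr] embeds T. *)
Definition action_monoid of right_action M T : Type := (M + T)%type.

Definition action_mul (u v : M + T) : M + T :=
  match u, v with
  | inl m, inl n => inl (m * n)
  | inr t, inl m => inr (act t m)
  | inl _, inr t => inr t
  | inr _, inr s => inr s
  end.

Lemma action_mulA : associative action_mul.
Proof.
by move=> [m|t] [n|s] [p|r] //=; rewrite ?mulgA ?ractM.
Qed.

Lemma action_mul1x : left_id (inl 1) action_mul.
Proof. by move=> [m|t] //=; rewrite mul1g. Qed.

Lemma action_mulx1 : right_id (inl 1) action_mul.
Proof. by move=> [m|t] /=; rewrite ?mulg1 ?ract1. Qed.

HB.instance Definition _ := Choice.copy (action_monoid act) (M + T)%type.
HB.instance Definition _ :=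
  isMonoid.Build (action_monoid act) action_mulA action_mul1x action_mulx1.

End ActionMonoid.

Section FreeAction.
Variables (X : choiceType) (T : Type) (step : T -> X -> T).

Lemma free_act1 t : foldl step t (1 : free_monoid X) = t.
Proof. by []. Qed.

Lemma free_actM t (u v : free_monoid X) :
  foldl step t (u * v) = foldl step (foldl step t u) v.
Proof. exact: foldl_cat. Qed.

Definition free_action : right_action (free_monoid X) T :=
  @RightAction (free_monoid X) T (foldl step) free_act1 free_actM.

End FreeAction.

Variant gen := Gx | Gy | Gy' | Gz | Gz'.

Definition nat_of_gen (g : gen) : nat :=
  match g with Gx => 0 | Gy => 1 | Gy' => 2 | Gz => 3 | Gz' => 4 end.

Definition gen_of_nat (n : nat) : option gen :=
  nth None [:: Some Gx; Some Gy; Some Gy'; Some Gz; Some Gz'] n.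

Lemma nat_of_genK : pcancel nat_of_gen gen_of_nat.
Proof. by case. Qed.

HB.instance Definition _ := Countable.copy gen (pcan_type nat_of_genK).

Definition inB (a : nat) : bool := [exists k : 'I_a.+1, a == 2 ^ k :> nat]%N.

Lemma inBP (a : nat) : reflect (exists k : nat, a = 2 ^ k)%N (inB a).
Proof.
apply: (iffP existsP) => [[k /eqP ak]|[k ak]]; first by exists k.
have ka : (k < a.+1)%N by rewrite ltnS ak ltnW // ltn_expl.
by exists (Ordinal ka); apply/eqP.
Qed.

Definition P : Type := (nat * int)%type.
HB.instance Definition _ := Choice.copy P (nat * int)%type.

Definition T : Type := option P.
HB.instance Definition _ := Choice.copy T (option P).

Definition pt (a : nat) (b : int) : T := Some (a, b).
Definition Omega : T := None.

Definition gen_act (t : T) (g : gen) : T :=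
  if t isn't Some (a, b) then Omega else
  match g with
  | Gx  => if b == 0%R then pt a.+1 0%R else Omega
  | Gy  => if ~~ inB a then pt a (b + 1)%R
           else if b == 0%R then pt a 0%R else Omega
  | Gy' => if ~~ inB a then pt a (b - 1)%R
           else if b == 0%R then pt a 0%R else Omega
  | Gz  => if ~~ inB a then pt a b else pt a (b + 1)%R
  | Gz' => if ~~ inB a then pt a b else pt a (b - 1)%R
  end.

Definition F : monoidType := free_monoid gen.
Definition FT_action : right_action F T := free_action gen_act.
Definition FT : monoidType := action_monoid FT_action.
Definition Zmon : monoidType := Algebra.to_multiplicative int.

Definition language (A : Type) := seq A -> Prop.

Record dfa (A : finType) := DFA {
  dfa_state : finType;
  dfa_start : dfa_state;
  dfa_final : pred dfa_state;
  dfa_trans : dfa_state -> A -> dfa_state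
}.

Definition dfa_accept (A : finType) (D : dfa A) (w : seq A) : bool :=
  dfa_final (foldl (@dfa_trans _ D) (dfa_start D) w).

Definition regular (A : finType) (L : language A) : Prop :=
  exists D : dfa A, forall w, L w <-> dfa_accept D w.

Definition prefix_closed (A : eqType) (L : language A) : Prop :=
  forall u w : seq A, prefix u w -> L w -> L u.

Section CrossSection.
Variables (N : monoidType) (A : {fset N}).

Definition word_val (w : seq A) : N := \prod_(a <- w) fsval a.

Definition generates : Prop := forall n : N, exists w : seq A, word_val w = n.

Definition cross_section (L : language A) : Prop :=
  generates /\ forall n : N, exists! w : seq A, L w /\ word_val w = n.

End CrossSection.

Definition has_prefix_closed_regular_cross_section (N : monoidType) : Prop :=
  exists (A : {fset N}) (L : language A),
    [/\ cross_section L, regular L & prefix_closed L].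

(* Main.v *)
Require Import Defs.
From HB Require Import structures.
From mathcomp Require Import all_boot all_order all_algebra.
From mathcomp Require Import finmap.

(* Give the generators [y], [z] (resp. [y'], [z']) the weight [1] (resp. [-1])
   in the factor Z, and [x] the weight [0]. From [p_(0,0)], the word
   [x^a y^i z^j] with signed exponents leads to [(p_(a,j), i + j)] when [a] is
   a power of two and to [(p_(a,i), i + j)] otherwise; in both cases
   [(i, j)] is mapped bijectively onto the pairs (second index, weight). Hence
   the normal forms [t x^a y^i z^j] for [P * Z], [s^n u] for the free part and
   [s^n omega] for [Omega], where [s] generates Z, form a language recognised
   by an automaton that only has to remember signs. *)

Set Implicit Arguments.
Unset Strict Implicit.
Unset Printing Implicit Defensive.

Import GRing.Theory.
Local Open Scope group_scope.

(** * Cross-sections from a labelled alphabet *)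

Section LabelledAlphabet.
Variables (N : monoidType) (I : finType) (f : I -> N).

(** Uniqueness comes for free: an accepted word is some [nf n], and its value is then [n], so the
    value determines the word. Injectivity of [f] identifies [I] with a finite subset of [N], along
    which the automaton is transported. *)
Lemma has_prefix_closed_regular_cross_section_labelled
    (D : dfa I) (nf : N -> seq I) :
    injective f ->
    (forall n, \prod_(i <- nf n) f i = n) ->
    (forall w, dfa_accept D w <-> exists n, w = nf n) ->
    (forall u v, dfa_accept D (u ++ v) -> dfa_accept D u) ->
  has_prefix_closed_regular_cross_section N.
Proof.
move=> f_inj nfK accP acc_prefix.
pose A : {fset N} := [fset n in map f (enum I)]%fset.
have fA i : f i \in A by rewrite inE map_f ?mem_enum.
pose h i : A := [` fA i]%fset.
have exg (a : A) : exists i, f i == val a.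
  by have := valP a; rewrite inE => /mapP[i _ ->]; exists i.
pose g a := xchoose (exg a).
have fg a : f (g a) = val a by apply/eqP/(xchooseP (exg a)).
have ghK : cancel h g by move=> i; apply: f_inj; rewrite fg.
have hgK : cancel g h by move=> a; apply: val_inj; rewrite /= fg.
have valE (w : seq A) : word_val w = \prod_(i <- map g w) f i.
  by rewrite /word_val big_map; apply: eq_bigr => a _; rewrite fg.
have val_nf n : word_val (map h (nf n)) = n by rewrite valE mapK.
exists A, (fun w => dfa_accept D (map g w)); split.
- split=> [n|n]; first by exists (map h (nf n)).
  exists (map h (nf n)); split=> [|w [/accP[m wE] <-]].
    by split=> //; apply/accP; exists n; rewrite mapK.
  by rewrite valE wE nfK -wE mapK.
- exists (@DFA A (dfa_state D) (dfa_start D) (@dfa_final _ D)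
    (fun s a => dfa_trans s (g a))) => w.
  by rewrite /dfa_accept /=; elim: w (dfa_start D) => //=.
- by move=> u w /prefixP[v ->]; rewrite map_cat => /acc_prefix.
Qed.

End LabelledAlphabet.

(** * Powers with integer exponents *)

Section SignedPowers.
Variables (A : Type) (l : bool -> A).

Definition signed (b : bool) (n : nat) : int := if b then Posz n else (- Posz n)%R.

(** The reduced word for an [i]-th power, with [l true] as the base and [l false] in the role of its
    inverse. *)
Definition spow (i : int) : seq A := nseq `|i|%N (l (0 <= i)%R).

Lemma spow_signed b n : nseq n.+1 (l b) = spow (signed b n.+1).
Proof. by case: b. Qed.

Lemma foldl_nseq_fixed (S : Type) (step : S -> A -> S) s a n :
  step s a = s -> foldl step s (nseq n a) = s.
Proof. by move=> sa; elim: n => //= n; rewrite sa. Qed.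

(** Evaluates a run along a family [t] indexed by the integers, on which the two letters act as the
    translations by 1 and -1. *)
Lemma foldl_spow (S : Type) (step : S -> A -> S) (t : int -> S) :
    (forall k b, step (t k) (l b) = t (k + signed b 1)%R) ->
  forall k i, foldl step (t k) (spow i) = t (k + i)%R.
Proof.
move=> stepE; have foldE b n k :
    foldl step (t k) (nseq n (l b)) = t (k + signed b n)%R.
  elim: n k => [|n IHn] k /=; first by case: b; rewrite /signed ?oppr0 addr0.
  rewrite stepE IHn -addrA; congr (t (_ + _)%R).
  by case: (b); rewrite /signed -?opprD -PoszD.
by move=> k [n|n]; rewrite /spow foldE.
Qed.

End SignedPowers.

(** * The alphabet and its values *)

Lemma gen_enumP : Finite.axiom [:: Gx; Gy; Gy'; Gz; Gz'].
Proof. by case. Qed.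
HB.instance Definition _ := isFinite.Build gen gen_enumP.

(* [Shift true] and [Shift false] generate the factor Z, [Base] is [p_(0,0)]
   and [Sink] is [Omega]. *)
Variant letter := Gen of gen | Shift of bool | Base | Sink.

Definition letter_code (l : letter) : gen + bool + bool :=
  match l with
  | Gen g => inl (inl g) | Shift b => inl (inr b)
  | Base => inr true | Sink => inr false
  end.

Definition letter_decode (c : gen + bool + bool) : letter :=
  match c with
  | inl (inl g) => Gen g | inl (inr b) => Shift b
  | inr b => if b then Base else Sink
  end.

Lemma letter_codeK : cancel letter_code letter_decode.
Proof. by case. Qed.
HB.instance Definition _ := Finite.copy letter (can_type letter_codeK).

Definition Ygen b := Gen (if b then Gy else Gy').
Definition Zgen b := Gen (if b then Gz else Gz').

Definition weight (g : gen) : int :=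
  match g with Gx => 0%R | Gy | Gz => 1%R | Gy' | Gz' => (-1)%R end.

Definition letter_val (l : letter) : (FT * Zmon)%type :=
  match l with
  | Gen g => (inl [:: g], weight g)
  | Shift b => (1, signed b 1)
  | Base => (inr (pt 0 0%R), 1)
  | Sink => (inr Omega, 1)
  end.

Lemma letter_val_inj : injective letter_val.
Proof.
move=> [g|b||] [h|c||] //; first by case=> ->.
by case: b c => [] [].
Qed.

Definition mul_letter (n : (FT * Zmon)%type) (l : letter) : (FT * Zmon)%type :=
  n * letter_val l.

Lemma prod_letter_val w : \prod_(l <- w) letter_val l = foldl mul_letter 1 w.
Proof.
suff foldE n : foldl mul_letter n w = n * \prod_(l <- w) letter_val l.
  by rewrite foldE mul1g.
elim: w n => [|l w IHw] n /=; first by rewrite big_nil mulg1.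
by rewrite IHw big_cons mulgA.
Qed.

(** * Evaluation of runs of letters *)

Lemma foldl_Shift i : foldl mul_letter 1 (spow Shift i) = (1, i).
Proof.
rewrite -[i in RHS]add0r.
by rewrite (foldl_spow (t := fun k : int => (1, k) : (FT * Zmon)%type)).
Qed.

Lemma foldl_Gen (u v : seq gen) (n : int) :
  foldl mul_letter (inl u, n) (map Gen v) =
    (inl (u ++ v), (n + \sum_(g <- v) weight g)%R).
Proof.
elim: v u n => [|g v IHv] u n /=; first by rewrite cats0 big_nil addr0.
rewrite -[mul_letter _ _]/(inl (u ++ [:: g]), (n + weight g)%R) IHv.
by rewrite -catA big_cons addrA.
Qed.

Lemma foldl_Gx a :
  foldl mul_letter (letter_val Base) (nseq a (Gen Gx)) =
    (inr (pt a 0%R), 0%R : int).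
Proof.
rewrite -[a in RHS]addn0 -[letter_val Base]/(inr (pt 0 0%R), 0%R : int).
elim: a 0%N => //= a IHa c.
by rewrite -[mul_letter _ _]/(inr (pt c.+1 0%R), 0%R : int) IHa addSnnS.
Qed.

Lemma foldl_Ygen a i :
  foldl mul_letter (inr (pt a 0%R), 0%R : int) (spow Ygen i) =
    (inr (pt a (if inB a then 0%R else i)), i).
Proof.
(* When [a] is a power of two, the second index stays 0, so each letter fixes the point and the
   exponent survives only in the factor Z. *)
pose t (k : int) : (FT * Zmon)%type :=
  (inr (pt a (if inB a then 0%R else k)), k).
have ->: (inr (pt a 0%R), 0%R : int) = t 0%R by rewrite /t; case: ifP.
rewrite (foldl_spow (t := t)) ?add0r // => k b.
rewrite /mul_letter /t; congr (_, _); last by case: b.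
by case: b => /=; congr inr; rewrite /=; case: (inB a).
Qed.

Lemma foldl_Zgen a b n j :
  foldl mul_letter (inr (pt a b), n : int) (spow Zgen j) =
    (inr (pt a (if inB a then (b + j)%R else b)), (n + j)%R).
Proof.
pose t (k : int) : (FT * Zmon)%type :=
  (inr (pt a (if inB a then (b + k)%R else b)), (n + k)%R).
have ->: (inr (pt a b), n : int) = t 0%R.
  by rewrite /t !addr0; case: ifP.
rewrite (foldl_spow (t := t)) ?add0r // => k c.
rewrite /mul_letter /t; congr (_, _); last by case: c; rewrite addrA.
by case: c => /=; congr inr; rewrite /=; case: (inB a); rewrite ?addrA.
Qed.

(** * Normal forms and their values *)

Definition orbit_word a i j : seq letter :=
  Base :: nseq a (Gen Gx) ++ spow Ygen i ++ spow Zgen j.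

(** The shift exponent compensates for the weight of the letters of [u]. On [P], the run that moves
    the second index has exponent [b], and the other run supplies the missing weight [k - b]. *)
Definition normal_form (n : (FT * Zmon)%type) : seq letter :=
  match n with
  | (inl u, k) => spow Shift (k - \sum_(g <- u) weight g)%R ++ map Gen u
  | (inr None, k) => rcons (spow Shift k) Sink
  | (inr (Some (a, b)), k) =>
      if inB a then orbit_word a (k - b)%R b else orbit_word a b (k - b)%R
  end.

Lemma prod_orbit_word a i j :
  \prod_(l <- orbit_word a i j) letter_val l =
    (inr (pt a (if inB a then j else i)), (i + j)%R).
Proof.
rewrite prod_letter_val /= -[mul_letter _ _]/(letter_val Base) !foldl_cat.
(* The order of the runs avoids [Omega]: x needs second index 0, y needs it at powers of two, and z
   never leads from [P] to [Omega]. *)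
rewrite foldl_Gx foldl_Ygen foldl_Zgen.
by case: (inB a); rewrite ?add0r.
Qed.

Lemma prod_normal_form n : \prod_(l <- normal_form n) letter_val l = n.
Proof.
case: n => [[u|[[a b]|]] k] /=.
- rewrite prod_letter_val foldl_cat foldl_Shift foldl_Gen.
  by congr (_, _); rewrite subrK.
- by case: ifP => aB; rewrite prod_orbit_word aB ?subrK ?subrKC.
- rewrite prod_letter_val foldl_rcons foldl_Shift /mul_letter.
  by congr (_, _); rewrite /=; apply: mulg1.
Qed.

(** * The automaton *)

(* The signs record the last letter read, so that no letter is ever followed
   by its inverse. *)
Variant state :=
  | Shifting of option bool | Free | Stop | Orbit
  | Yrun of bool | Zrun of bool | Dead.

Definition state_code (s : state) :
    option bool + (bool + bool) + (bool + bool) :=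
  match s with
  | Shifting c => inl (inl c)
  | Free => inl (inr (inl true)) | Stop => inl (inr (inl false))
  | Orbit => inl (inr (inr true)) | Dead => inl (inr (inr false))
  | Yrun b => inr (inl b) | Zrun b => inr (inr b)
  end.

Definition state_decode (c : option bool + (bool + bool) + (bool + bool)) :=
  match c with
  | inl (inl c) => Shifting c
  | inl (inr (inl b)) => if b then Free else Stop
  | inl (inr (inr b)) => if b then Orbit else Dead
  | inr (inl b) => Yrun b | inr (inr b) => Zrun b
  end.

Lemma state_codeK : cancel state_code state_decode.
Proof. by case. Qed.
HB.instance Definition _ := Finite.copy state (can_type state_codeK).

(** [Base] may only come first, since the y and z runs already produce every weight; [Sink] may
    follow shifts but ends the word. *)
Definition next (s : state) (l : letter) : state :=
  match s, l with
  | Shifting None, Base => Orbit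
  | Shifting None, Shift b => Shifting (Some b)
  | Shifting (Some c), Shift b => if b == c then Shifting (Some c) else Dead
  | Shifting _, Sink => Stop
  | Shifting _, Gen _ | Free, Gen _ => Free
  | Orbit, Gen Gx => Orbit
  | Orbit, Gen Gy => Yrun true
  | Orbit, Gen Gy' => Yrun false
  | Yrun b, Gen Gy => if b then Yrun true else Dead
  | Yrun b, Gen Gy' => if b then Dead else Yrun false
  | (Orbit | Yrun _), Gen Gz => Zrun true
  | (Orbit | Yrun _), Gen Gz' => Zrun false
  | Zrun b, Gen Gz => if b then Zrun true else Dead
  | Zrun b, Gen Gz' => if b then Dead else Zrun false
  | _, _ => Dead
  end.

Definition normal_dfa : dfa letter :=
  @DFA letter state (Shifting None) (predC1 Dead) next.

(** * Accepted words are normal forms *)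

Definition live (s : state) (w : seq letter) : bool := foldl next s w != Dead.

Lemma live_Dead w : live Dead w = false.
Proof. by rewrite /live; elim: w. Qed.

(** [Dead] is absorbing, so no prefix of a live word can reach it. This gives prefix-closure. *)
Lemma live_catl s u v : live s (u ++ v) -> live s u.
Proof.
rewrite {1}/live foldl_cat => uv; apply/negP => /eqP u0.
by move: uv; rewrite u0 -/(live Dead v) live_Dead.
Qed.

Lemma live_Stop w : live Stop w -> w = [::].
Proof. by case: w => //= l w; rewrite -[live _ _]/(live Dead w) live_Dead. Qed.

Lemma live_Free w : live Free w -> exists u, w = map Gen u.
Proof.
elim: w => [|l w IHw]; first by exists [::].
case: l => [g /IHw[u ->]|b||]; first by exists (g :: u).
all: by rewrite -[live _ _]/(live Dead w) live_Dead.
Qed.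

Lemma live_Zrun b w : live (Zrun b) w -> w = nseq (size w) (Zgen b).
Proof.
elim: w => //= l w IHw; rewrite -[live _ _]/(live (next (Zrun b) l) w).
by case: l b IHw => [[]|b'||] [] IHw; rewrite /= ?live_Dead // => /IHw{1}->.
Qed.

Lemma live_Zrun_spow b w :
  live (Zrun b) w -> exists j, Zgen b :: w = spow Zgen j.
Proof.
move=> /live_Zrun ->; exists (signed b (size w).+1); exact: spow_signed.
Qed.

(** The y run is written with [nseq] and the fixed sign [b], because [spow] forgets the sign of an
    empty run and the induction must prepend [Ygen b]. *)
Lemma live_Yrun b w :
  live (Yrun b) w -> exists n j, w = nseq n (Ygen b) ++ spow Zgen j.
Proof.
elim: w => [|l w IHw]; first by exists 0%N, 0%R.
rewrite -[live _ _]/(live (next (Yrun b) l) w).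
have runY : live (Yrun b) w -> exists n j,
    Ygen b :: w = nseq n (Ygen b) ++ spow Zgen j.
  by move=> /IHw[n [j ->]]; exists n.+1, j.
have runZ c : live (Zrun c) w -> exists n j,
    Zgen c :: w = nseq n (Ygen b) ++ spow Zgen j.
  by move=> /live_Zrun_spow[j ->]; exists 0%N, j.
case: l b {IHw} runY runZ => [[]|b'||] [] runY runZ; rewrite /= ?live_Dead //.
all: first [exact: runY | exact: (runZ true) | exact: (runZ false)].
Qed.

Lemma live_Yrun_spow b w :
  live (Yrun b) w -> exists i j, Ygen b :: w = spow Ygen i ++ spow Zgen j.
Proof.
move=> /live_Yrun[n [j ->]]; exists (signed b n.+1), j.
by rewrite -spow_signed.
Qed.

Lemma live_Orbit w :
  live Orbit w -> exists a i j, Base :: w = orbit_word a i j.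
Proof.
suff: live Orbit w -> exists a i j,
    w = nseq a (Gen Gx) ++ spow Ygen i ++ spow Zgen j.
  by move=> wP /wP[a [i [j ->]]]; exists a, i, j.
elim: w => [|l w IHw]; first by exists 0%N, 0%R, 0%R.
rewrite -[live _ _]/(live (next Orbit l) w).
have runY b : live (Yrun b) w -> exists a i j,
    Ygen b :: w = nseq a (Gen Gx) ++ spow Ygen i ++ spow Zgen j.
  by move=> /live_Yrun_spow[i [j ->]]; exists 0%N, i, j.
have runZ b : live (Zrun b) w -> exists a i j,
    Zgen b :: w = nseq a (Gen Gx) ++ spow Ygen i ++ spow Zgen j.
  by move=> /live_Zrun_spow[j ->]; exists 0%N, 0%R, j.
case: l => [[]|b||]; rewrite /= ?live_Dead //.
- by move=> /IHw[a [i [j ->]]]; exists a.+1, i, j.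
- exact: (runY true).
- exact: (runY false).
- exact: (runZ true).
- exact: (runZ false).
Qed.

Lemma live_Shifting b w : live (Shifting (Some b)) w ->
  exists n v, w = nseq n (Shift b) ++ v
    /\ (v = [:: Sink] \/ exists u, v = map Gen u).
Proof.
elim: w => [|l w IHw]; first by exists 0%N, [::]; split=> //; right; exists [::].
rewrite -[live _ _]/(live (next (Shifting (Some b)) l) w).
case: l => [g|c||] /=; rewrite ?live_Dead //.
- move=> /live_Free[u ->]; exists 0%N, (map Gen (g :: u)).
  by split=> //; right; exists (g :: u).
- case: eqP => [->|_]; rewrite ?live_Dead // => /IHw[n [v [-> vP]]].
  by exists n.+1, v.
- by move=> /live_Stop->; exists 0%N, [:: Sink]; split=> //; left.
Qed.

Lemma orbit_word_normal a i j : exists n, orbit_word a i j = normal_form n.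
Proof.
(* The witness is the value of the word, as given by [prod_orbit_word]. *)
exists (inr (pt a (if inB a then j else i)), (i + j)%R) => /=.
by case: (inB a); rewrite ?addrK // [(i + j)%R]addrC addrK.
Qed.

Lemma shift_word_normal i v :
    v = [:: Sink] \/ (exists u, v = map Gen u) ->
  exists n, spow Shift i ++ v = normal_form n.
Proof.
case=> [->|[u ->]]; first by exists (inr Omega, i); rewrite /= cats1.
by exists (inl u, (i + \sum_(g <- u) weight g)%R); rewrite /= addrK.
Qed.

Lemma live_normal w : live (Shifting None) w -> exists n, w = normal_form n.
Proof.
case: w => [|l w]; first by exists (inl [::], 0%R); rewrite /= big_nil.
rewrite -[live _ _]/(live (next (Shifting None) l) w).
case: l => [g|b||] /=.
- move=> /live_Free[u ->].
  (* Exponent 0 stands for the empty run of shifts. *)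
  by apply: (@shift_word_normal 0%R); right; exists (g :: u).
- move=> /live_Shifting[n [v [-> /shift_word_normal vP]]].
  by rewrite -cat_cons -[Shift b :: _]/(nseq n.+1 (Shift b)) spow_signed.
- move=> /live_Orbit[a [i [j ->]]]; exact: orbit_word_normal.
- by move=> /live_Stop->; apply: (@shift_word_normal 0%R); left.
Qed.

(** * Normal forms are accepted *)

Lemma next_spow_Shift i :
  exists c, foldl next (Shifting None) (spow Shift i) = Shifting c.
Proof.
rewrite /spow; case: `|i|%N => [|n]; first by exists None.
by exists (Some (0 <= i)%R); rewrite /= foldl_nseq_fixed //= eqxx.
Qed.

(** The two alternatives for [s] are the states reached after an empty and after a nonempty run of
    y. *)
Lemma live_spow_Zgen s i :
  s = Orbit \/ (exists b, s = Yrun b) -> live s (spow Zgen i).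
Proof.
rewrite /live /spow; case: `|i|%N => [|n]; first by case=> [->|[b ->]].
move: (0 <= i)%R => c sP /=.
have ->: next s (Zgen c) = Zrun c by case: c; case: sP => [->|[b ->]].
by rewrite foldl_nseq_fixed //; case: c.
Qed.

Lemma live_orbit_word a i j : live (Shifting None) (orbit_word a i j).
Proof.
rewrite /live /= foldl_cat foldl_nseq_fixed // foldl_cat.
apply: live_spow_Zgen; rewrite /spow; case: `|i|%N => [|n]; first by left.
by right; exists (0 <= i)%R; case: (0 <= i)%R; rewrite /= foldl_nseq_fixed.
Qed.

Lemma live_normal_form n : live (Shifting None) (normal_form n).
Proof.
case: n => [[u|[[a b]|]] k] /=.
- move: (k - _)%R => i; rewrite /live foldl_cat.
  have [c ->] := next_spow_Shift i.
  by case: u => [|g u] /=; case: c => //= *; elim: u.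
- by case: ifP => _; apply: live_orbit_word.
- by rewrite /live foldl_rcons; have [[c|] ->] := next_spow_Shift k.
Qed.

Theorem proposition3p1 :
  has_prefix_closed_regular_cross_section (FT * Zmon)%type.
Proof.
apply: (has_prefix_closed_regular_cross_section_labelled (D := normal_dfa)
          letter_val_inj prod_normal_form) => [w|u v].
  by split=> [/live_normal|[n ->]] //; apply: live_normal_form.
exact: live_catl.
Qed.
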